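(* Let $k$ be a field of characteristic zero, $P_n=k[x_1,\ldots,x_n]$, let $F$ be an $n$-tuple of elements of $P_n$, and let $D=D_F$. Let $\lambda:\mathrm{NSymm}\to\mathrm{Hom}_k(P_n,P_n)$ be the representation of $\mathrm{NSymm}$ on $P_n$ associated with $F$. Then $\lambda(\mathrm{Prim})=L_D$ and $\lambda(\mathrm{NSymm})=A_D$.
   Context: $\mathrm{NSymm}=k\langle Z_1,Z_2,\ldots\rangle$ is the free associative unital algebra in the variables $Z_1,Z_2,\ldots$, made into a Hopf algebra with comultiplication the algebra map $\bigtriangleup(Z_n)=\sum_{i+j=n}Z_i\otimes Z_j$ ($i,j\ge0$, $Z_0=1$) and counit $\varepsilon(Z_n)=0$ for $n\ge1$. $\mathrm{Prim}=\{p\in\mathrm{NSymm}\mid\bigtriangleup(p)=p\otimes1+1\otimes p\}$ is the Lie algebra of primitive elements. For $F=(f_1,\ldots,f_n)$ and an independent parameter $t$, let $(X+tF)^*$ be the $k[t]$-algebra endomorphism of $P_n[t]$ sending $x_i\mapsto x_i+tf_i$. The map $\lambda$ is the unital algebra homomorphism to $\mathrm{Hom}_k(P_n,P_n)$ (with composition of maps as product) determined by $(X+tF)^*(a)=a+\sum_{i\ge1}t^i\lambda(Z_i)(a)$ for all $a\in P_n$. Write $\partial_i=\partial/\partial x_i$ and $D_F=f_1\partial_1+\cdots+f_n\partial_n$. The space of all $k$-linear derivations of $P_n$ carries the left-symmetric product determined by $(a\partial_i)\cdot(b\partial_j)=\big(a\,\partial_i(b)\big)\partial_j$ for $a,b\in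 P_n$. The right powers of $D$ are $D^{[1]}=D$, $D^{[r+1]}=D^{[r]}\cdot D$ for $r\ge1$. $W_n$ is the Lie algebra of all derivations of $P_n$ (commutator bracket) and $A_n$ is the Weyl algebra of all linear differential operators on $P_n$, viewed inside $\mathrm{Hom}_k(P_n,P_n)$. $L_D$ is the Lie subalgebra of $W_n$ generated by all $D^{[m]}$, $m\ge1$, and $A_D$ is the subalgebra with identity of $A_n$ generated by all $D^{[m]}$, $m\ge1$. *)

(* Defs.v *)
From HB Require Import structures.
From mathcomp Require Import all_boot all_algebra finmap.
From mathcomp.classical Require Import boolp classical_sets.
From mathcomp.multinomials Require Import monalg mpoly.

Set Implicit Arguments.
Unset Strict Implicit.
Unset Printing Implicit Defensive.

Import GRing.Theory.
(* monalg gives this notation another meaning. *)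
Local Notation "{ 'mpoly' T [ n ] }" := (mpoly.mpoly n T) : type_scope.
Local Open Scope classical_set_scope.
Local Open Scope ring_scope.

(* Hom_k(P_n, P_n), with composition as product. *)
Definition endo (k : fieldType) (n : nat) : Type :=
  {linear {mpoly k[n]} -> {mpoly k[n]}}.

Section Endo.
Variables (k : fieldType) (n : nat).
Local Notation P := {mpoly k[n]}.
Implicit Types (f g h : endo k n) (a b : P) (c : k).

HB.instance Definition _ := gen_eqMixin (endo k n).
HB.instance Definition _ := gen_choiceMixin (endo k n).

Lemma endoP f g : f =1 g -> f = g.
Proof.
case: f g => [f [[f1] [f2]]] [g [[g1] [g2]]] /= /funext fg.
by case: _ / fg f1 f2 g1 g2 => *; congr GRing.Linear.Pack;
  congr GRing.Linear.Class;
  [congr Algebra.isNmodMorphism.Axioms_ | congr GRing.isScalable.Axioms_];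
  exact: Prop_irrelevance.
Qed.

Definition endo_of (f : P -> P) (lf : linear f) : endo k n :=
  HB.pack f (GRing.isLinear.Build k P P *:%R f lf).

Definition endo0 : endo k n := \0.
Definition endo_opp f : endo k n := \- f.
Definition endo_add f g : endo k n := f \+ g.
Definition endo1 : endo k n := idfun.
Definition endo_mul f g : endo k n := f \o g.

Fact endo_scale_subproof c f : linear (c \*: f).
Proof.
by move=> d a b /=; rewrite linearP scalerDr !scalerA mulrC.
Qed.
Definition endo_scale c f : endo k n := endo_of (endo_scale_subproof c f).

Fact endo_addA : associative endo_add.
Proof. by move=> f g h; apply: endoP => a /=; rewrite addrA. Qed.
Fact endo_addC : commutative endo_add.
Proof. by move=> f g; apply: endoP => a /=; rewrite addrC. Qed.
Fact endo_add0 : left_id endo0 endo_add.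
Proof. by move=> f; apply: endoP => a /=; rewrite add0r. Qed.
Fact endo_addN : left_inverse endo0 endo_opp endo_add.
Proof. by move=> f; apply: endoP => a /=; rewrite addNr. Qed.
HB.instance Definition _ := GRing.isZmodule.Build (endo k n)
  endo_addA endo_addC endo_add0 endo_addN.

Fact endo_mulA : associative endo_mul.
Proof. by move=> f g h; apply: endoP. Qed.
Fact endo_mul1l : left_id endo1 endo_mul.
Proof. by move=> f; apply: endoP. Qed.
Fact endo_mul1r : right_id endo1 endo_mul.
Proof. by move=> f; apply: endoP. Qed.
Fact endo_mulDl : left_distributive endo_mul +%R.
Proof. by move=> f g h; apply: endoP. Qed.
Fact endo_mulDr : right_distributive endo_mul +%R.
Proof. by move=> f g h; apply: endoP => a /=; rewrite linearD. Qed.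
Fact endo_1neq0 : endo1 != 0.
Proof.
apply/eqP => e; have /eqP := congr1 (fun f : endo k n => f 1 : P) e.
by rewrite oner_eq0.
Qed.
HB.instance Definition _ := GRing.Zmodule_isNzRing.Build (endo k n)
  endo_mulA endo_mul1l endo_mul1r endo_mulDl endo_mulDr endo_1neq0.

Fact endo_scaleA c d f : endo_scale c (endo_scale d f) = endo_scale (c * d) f.
Proof. by apply: endoP => a /=; rewrite scalerA. Qed.
Fact endo_scale1 : left_id 1 endo_scale.
Proof. by move=> f; apply: endoP => a /=; rewrite scale1r. Qed.
Fact endo_scaleDr : right_distributive endo_scale +%R.
Proof. by move=> c f g; apply: endoP => a /=; rewrite scalerDr. Qed.
Fact endo_scaleDl f : {morph endo_scale^~ f : c d / c + d}.
Proof. by move=> c d; apply: endoP => a /=; rewrite scalerDl. Qed.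
HB.instance Definition _ := GRing.Zmodule_isLmodule.Build k (endo k n)
  endo_scaleA endo_scale1 endo_scaleDr endo_scaleDl.

Fact endo_scaleAl c f g : c *: (f * g) = (c *: f) * g.
Proof. by apply: endoP. Qed.
HB.instance Definition _ :=
  GRing.Lmodule_isLalgebra.Build k (endo k n) endo_scaleAl.
Fact endo_scaleAr c f g : c *: (f * g) = f * (c *: g).
Proof. by apply: endoP => a /=; rewrite -[RHS]/(f (c *: g a)) linearZ. Qed.
HB.instance Definition _ :=
  GRing.Lalgebra_isAlgebra.Build k (endo k n) endo_scaleAr.

Lemma endo0E a : (0 : endo k n) a = 0. Proof. by []. Qed.
Lemma endoDE f g a : (f + g) a = f a + g a. Proof. by []. Qed.
Lemma endoNE f a : (- f) a = - f a. Proof. by []. Qed.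
Lemma endoZE c f a : (c *: f) a = c *: f a. Proof. by []. Qed.
Lemma endo1E a : (1 : endo k n) a = a. Proof. by []. Qed.
Lemma endoME f g a : (f * g) a = f (g a). Proof. by []. Qed.
Lemma endo_sumE I r (Q : pred I) (F : I -> endo k n) a :
  (\sum_(i <- r | Q i) F i) a = \sum_(i <- r | Q i) F i a.
Proof. by elim/big_rec2: _ => // i b f _ <-. Qed.

Fact mulop_subproof a : linear ( *%R a).
Proof. by move=> c b d; rewrite mulrDr scalerAr. Qed.
Definition mulop a : endo k n := endo_of (mulop_subproof a).

Fact pder_subproof i : linear (@mderiv n k i).
Proof. exact: linearP. Qed.
Definition pder i : endo k n := endo_of (pder_subproof i).

Lemma mulopE a b : mulop a b = a * b. Proof. by []. Qed.
Lemma pderE i a : pder i a = a^`M(i). Proof. by []. Qed.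

Definition D_F (F : n.-tuple P) : endo k n :=
  \sum_(i < n) mulop (tnth F i) * pder i.

End Endo.

Section Generated.
Variables (k : fieldType) (n : nat).
Local Notation P := {mpoly k[n]}.
Implicit Types (f g d e : endo k n) (S : set (endo k n)).

Definition subspace S := S 0 /\ forall (c : k) f g, S f -> S g -> S (c *: f + g).

Definition lie_subalgebra S :=
  subspace S /\ forall f g, S f -> S g -> S (f * g - g * f).

Definition unital_subalgebra S :=
  [/\ subspace S, S 1 & forall f g, S f -> S g -> S (f * g)].

Definition derivations : set (endo k n) :=
  [set d | forall a b : P, d (a * b) = d a * b + a * d b].

(* A_n, as the subalgebra of Hom_k(P_n, P_n) generated by the operators of
   multiplication by the x_i and by the d_i. *)
Definition weyl : set (endo k n) :=
  smallest unital_subalgebra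
    (range (fun i : 'I_n => mulop 'X_i) `|` range (@pder k n)).

(* The left-symmetric product of derivations: with d = sum_i d(x_i) d_i and
   e = sum_j e(x_j) d_j, bilinearity and (a d_i).(b d_j) = (a d_i(b)) d_j give
   d.e = sum_j d(e(x_j)) d_j. *)
Definition lsprod d e : endo k n :=
  \sum_(j < n) mulop (d (e 'X_j)) * pder k j.

(* The value at m = 0 is meaningless. *)
Definition rpow d (m : nat) : endo k n := iter m.-1 (fun e => lsprod e d) d.

Definition rpows d : set (endo k n) := [set rpow d m | m in [set m | (0 < m)%N]].

Definition lie_gen d : set (endo k n) :=
  smallest (fun S => lie_subalgebra S /\ S `<=` derivations) (rpows d).

Definition alg_gen d : set (endo k n) :=
  smallest (fun S => unital_subalgebra S /\ S `<=` weyl) (rpows d).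

Lemma lsprodDl d d' e : lsprod (d + d') e = lsprod d e + lsprod d' e.
Proof.
rewrite /lsprod -big_split /=; apply: eq_bigr => j _; apply: endoP => a.
by rewrite /= mulrDl.
Qed.

Lemma lsprodZl (c : k) d e : lsprod (c *: d) e = c *: lsprod d e.
Proof.
rewrite /lsprod scaler_sumr; apply: eq_bigr => j _; apply: endoP => a.
by rewrite /= scalerAl.
Qed.

Lemma lsprodDr d e e' : lsprod d (e + e') = lsprod d e + lsprod d e'.
Proof.
rewrite /lsprod -big_split /=; apply: eq_bigr => j _; apply: endoP => a.
by rewrite /= linearD mulrDl.
Qed.

Lemma lsprodZr (c : k) d e : lsprod d (c *: e) = c *: lsprod d e.
Proof.
rewrite /lsprod scaler_sumr; apply: eq_bigr => j _; apply: endoP => a.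
by rewrite /= linearZ scalerAl.
Qed.

Lemma lsprod_pder (a b : P) i j :
  lsprod (mulop a * pder k i) (mulop b * pder k j)
    = mulop (a * b^`M(i)) * pder k j.
Proof.
have dX l : ('X_l : P)^`M(j) = (l == j)%:R.
  rewrite mderivX mnm1E; case: eqVneq => [->|_]; last by rewrite scale0r.
  rewrite scale1r (_ : (_ - _)%MM = 0%MM) ?mpolyX0 //.
  by apply/mnmP => i'; rewrite mnmBE mnm0E subnn.
rewrite /lsprod (bigD1 j) //= big1 ?addr0 => [|l /negPf nlj]; last first.
  by apply: endoP => p; rewrite !endoME !mulopE !pderE dX nlj mulr0 mderiv0
    mulr0 mul0r.
by apply: endoP => p; rewrite !endoME !mulopE !pderE dX eqxx mulr1.
Qed.

Lemma derivations_sum (a : 'I_n -> P) :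
  derivations (\sum_(j < n) mulop (a j) * pder k j).
Proof.
move=> p q; rewrite !endo_sumE mulr_suml mulr_sumr -big_split /=.
apply: eq_bigr => j _.
by rewrite mderivM mulrDr !mulrA [p * a j]mulrC.
Qed.

Lemma derivationsE d : derivations d ->
  d = \sum_(j < n) mulop (d 'X_j) * pder k j.
Proof.
move=> dd; set e := RHS; have de : derivations e by apply: derivations_sum.
have d1 f : derivations f -> f 1 = 0.
  move=> df; have := df 1 1; rewrite !mulr1 mul1r => /(congr1 (+%R^~ (- f 1))).
  by rewrite subrr addrK.
apply: endoP => p; rewrite (mpolyE p) !linear_sum; apply: eq_bigr => m _.
rewrite !linearZ; congr (_ *: _); rewrite mpolyXE_id.
pose eqde a := d a = e a; rewrite -/(eqde _).
have eqM a b : eqde a -> eqde b -> eqde (a * b).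
  by rewrite /eqde dd de => -> ->.
have eq1 : eqde 1 by rewrite /eqde !d1.
elim/big_ind: _ => // i _; elim: (m i) => // l IHl; rewrite exprS; apply: eqM => //.
rewrite /eqde /e endo_sumE (bigD1 i) //= big1 ?addr0 => [|l' /negPf nl].
  rewrite mderivX mnm1E eqxx scale1r (_ : (_ - _)%MM = 0%MM) ?mpolyX0 ?mulr1 //.
  by apply/mnmP => i'; rewrite mnmBE mnm0E subnn.
by rewrite mderivX mnm1E eq_sym nl scale0r mulr0.
Qed.

End Generated.

Section MalgTensor.
Variables (k : fieldType) (M N : monomType).

Definition prod_mone : M * N := (mone, mone).
Definition prod_mmul (u v : M * N) : M * N := (mmul u.1 v.1, mmul u.2 v.2).

Fact prod_mmulA : associative prod_mmul.
Proof. by move=> u v w; rewrite /prod_mmul !mulmA. Qed.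
Fact prod_mmul1m : left_id prod_mone prod_mmul.
Proof. by case=> u v; rewrite /prod_mmul !mul1m. Qed.
Fact prod_mmulm1 : right_id prod_mone prod_mmul.
Proof. by case=> u v; rewrite /prod_mmul !mulm1. Qed.
Fact prod_munit (u v : M * N) :
  prod_mmul u v = prod_mone -> u = prod_mone /\ v = prod_mone.
Proof.
by case: u v => [u u'] [v v'] [/unitm[/= -> ->] /unitm[/= -> ->]].
Qed.
HB.instance Definition _ := Choice_isMonomialDef.Build (M * N)%type
  prod_mmulA prod_mmul1m prod_mmulm1 prod_munit.

(* k[M] (x) k[N] is realised as the monoid algebra k[M x N], the pure tensor
   u (x) v of basis elements being the basis element (u, v). *)
Definition tens (p : {malg k[M]}) (q : {malg k[N]}) : {malg k[(M * N)%type]} :=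
  \sum_(u <- monalg.msupp p) \sum_(v <- monalg.msupp q)
    << monalg.mcoeff u p * monalg.mcoeff v q *g (u, v) >>.

Lemma mcoeff_tens p q u v : monalg.mcoeff (u, v) (tens p q) =
  monalg.mcoeff u p * monalg.mcoeff v q.
Proof.
rewrite /tens raddf_sum /=.
under eq_bigr do rewrite raddf_sum /=.
under eq_bigr do under eq_bigr do rewrite monalg.mcoeffU xpair_eqE.
have [up|/monalg.mcoeff_outdom pu] := boolP (u \in monalg.msupp p); last first.
  rewrite pu mul0r big_seq big1 // => u' u'p; rewrite big1 // => v' _.
  by case: eqVneq u'p => //= ->; rewrite -monalg.mcoeff_neq0 pu eqxx.
rewrite (big_fsetD1 u) //= [X in _ + X]big_seq [X in _ + X]big1 ?addr0; last first.
  by move=> u'; rewrite in_fsetD1 => /andP[/negPf nu _]; rewrite big1 // => v' _;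
    rewrite nu mulr0n.
have [vq|/monalg.mcoeff_outdom qv] := boolP (v \in monalg.msupp q); last first.
  rewrite qv mulr0 big_seq big1 // => v' v'q.
  by case: (eqVneq v' v) v'q => [->|_]; rewrite ?andbF // -monalg.mcoeff_neq0 qv eqxx.
rewrite (big_fsetD1 v) //= [X in _ + X]big_seq [X in _ + X]big1 ?addr0 ?eqxx //.
by move=> v'; rewrite in_fsetD1 => /andP[/negPf nv _]; rewrite nv andbF.
Qed.

End MalgTensor.

Section MalgAlgebra.
Variables (k : fieldType) (M : monomType).

Lemma malg_scaleAr (c : k) (p q : {malg k[M]}) : c *: (p * q) = p * (c *: q).
Proof.
apply/malgP => w; rewrite monalg.mcoeffZ;
  rewrite (monalg.mcoeffMlw _ (fsubset_refl _) (fsubset_refl _)).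
rewrite (monalg.mcoeffMlw _ (fsubset_refl _) (monalg.msuppZ_le c q)) mulr_sumr.
apply: eq_bigr => u _; rewrite mulr_sumr; apply: eq_bigr => v _.
by rewrite monalg.mcoeffZ mulrnAr mulrCA.
Qed.
End MalgAlgebra.

(* The letter j : nat stands for the variable Z_{j+1}. *)
Definition nsymm (k : fieldType) : Type := {malg k[{fmonom nat}]}.
HB.instance Definition _ (k : fieldType) :=
  GRing.Lalgebra.copy (nsymm k) {malg k[{fmonom nat}]}.
HB.instance Definition _ (k : fieldType) :=
  GRing.Lalgebra_isAlgebra.Build k (nsymm k) (@malg_scaleAr k {fmonom nat}).

Definition nsymm2 (k : fieldType) : Type :=
  {malg k[({fmonom nat} * {fmonom nat})%type]}.
HB.instance Definition _ (k : fieldType) :=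
  GRing.Lalgebra.copy (nsymm2 k) {malg k[({fmonom nat} * {fmonom nat})%type]}.
HB.instance Definition _ (k : fieldType) :=
  GRing.Lalgebra_isAlgebra.Build k (nsymm2 k)
    (@malg_scaleAr k ({fmonom nat} * {fmonom nat})%type).

Definition Z (k : fieldType) (i : nat) : nsymm k :=
  if i is j.+1 then << fmu j >> else 1.

Section FreeLift.
Variables (k : fieldType) (A : algType k) (f : nat -> A).

Definition free_word (w : {fmonom nat}) : A := \prod_(j <- w) f j.+1.

Fact free_word_mmorphism : mmorphism free_word.
Proof.
split=> [u v|]; first by rewrite /free_word fmM big_cat.
by rewrite /free_word fm1 big_nil.
Qed.
HB.instance Definition _ :=
  isMultiplicative.Build {fmonom nat} A free_word free_word_mmorphism.

(* The algebra morphism NSymm -> A with Z_i |-> f i for i >= 1; f 0 is unused. *)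
Definition free_lift (p : nsymm k) : A := monalg.mmap (in_alg A) free_word p.

Fact free_lift_additive : additive free_lift.
Proof. by move=> p q; rewrite /free_lift raddfB. Qed.
HB.instance Definition _ :=
  GRing.isAdditive.Build (nsymm k) A free_lift free_lift_additive.

Fact free_lift_multiplicative : multiplicative free_lift.
Proof.
by apply: monalg.commr_mmap_is_multiplicative => p u v; apply: comm_alg.
Qed.
HB.instance Definition _ :=
  GRing.isMultiplicative.Build (nsymm k) A free_lift free_lift_multiplicative.

Fact free_lift_scalable : scalable free_lift.
Proof. by move=> c p; rewrite /free_lift monalg.mmapZ /= mulr_algl. Qed.
HB.instance Definition _ :=
  GRing.isScalable.Build k (nsymm k) A *:%R free_lift free_lift_scalable.

Lemma free_liftZ i : (0 < i)%N -> free_lift (Z k i) = f i.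
Proof.
case: i => // j _; rewrite /free_lift /Z monalg.mmapU /= scale1r mul1r.
by rewrite /free_word fmU big_seq1.
Qed.

End FreeLift.

Section Hopf.
Variable k : fieldType.

Definition tens2 (p q : nsymm k) : nsymm2 k := tens p q.

Definition Delta : nsymm k -> nsymm2 k :=
  free_lift (fun i => \sum_(j < i.+1) tens2 (Z k j) (Z k (i - j))).

Definition Prim : set (nsymm k) :=
  [set p | Delta p = tens2 p 1 + tens2 1 p].

End Hopf.

Section Lambda.
Variables (k : fieldType) (n : nat) (F : n.-tuple {mpoly k[n]}).
Local Notation P := {mpoly k[n]}.

Definition const_t (c : k) : {poly P} := (mpolyC n c)%:P.

Definition subst_var (i : 'I_n) : {poly P} := ('X_i : P)%:P + 'X * (tnth F i)%:P.

Definition XtF_P (a : P) : {poly P} := mpoly.mmap const_t subst_var a.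

(* (X + tF)^*, on P_n[t] = {poly P}; the parameter t is 'X. *)
Definition XtF (p : {poly P}) : {poly P} := (map_poly XtF_P p).['X].

HB.instance Definition _ := GRing.RMorphism.copy const_t (polyC \o @mpolyC n k).
HB.instance Definition _ := GRing.RMorphism.copy XtF_P (mpoly.mmap const_t subst_var).

Fact XtF_comm : commr_rmorph XtF_P ('X : {poly P}).
Proof. by move=> a; apply: mulrC. Qed.

Lemma XtFE p : XtF p = horner_morph XtF_comm p.
Proof. by []. Qed.

HB.instance Definition _ := GRing.RMorphism.copy XtF (horner_morph XtF_comm).

Lemma XtF_const (c : k) : XtF (mpolyC n c)%:P = (mpolyC n c)%:P.
Proof. by rewrite XtFE horner_morphC /= /XtF_P mpoly.mmapC. Qed.

Lemma XtF_t : XtF 'X = 'X.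
Proof. by rewrite XtFE horner_morphX. Qed.

Lemma XtF_var i : XtF ('X_i : P)%:P = ('X_i : P)%:P + 'X * (tnth F i)%:P.
Proof. by rewrite XtFE horner_morphC /= /XtF_P mmapX mmap1U. Qed.

Lemma XtF_coef0 (a : P) : (XtF a%:P)`_0 = a.
Proof.
rewrite XtFE horner_morphC /= -horner_coef0 /XtF_P.
rewrite /mpoly.mmap horner_sum [RHS]mpolyE; apply: eq_bigr => m _.
rewrite hornerM hornerC -mul_mpolyC /mmap1 horner_prod mpolyXE_id.
congr (_ * _); apply: eq_bigr => i _.
by rewrite horner_exp hornerD hornerM hornerX hornerC mul0r addr0.
Qed.

Fact lambda_coef_subproof i : linear (fun a : P => (XtF a%:P)`_i).
Proof.
move=> c a b; rewrite -[c *: a]mul_mpolyC polyCD polyCM rmorphD rmorphM /=.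
by rewrite XtF_const coefD coefCM mul_mpolyC.
Qed.
Definition lambda_coef (i : nat) : endo k n := endo_of (lambda_coef_subproof i).

Definition lambda : nsymm k -> endo k n := free_lift lambda_coef.

Lemma lambdaZ (i : nat) (a : P) : lambda (Z k i) a = (XtF a%:P)`_i.
Proof.
case: i => [|i]; last by rewrite /lambda free_liftZ.
by rewrite /lambda rmorph1 XtF_coef0.
Qed.

End Lambda.

(* Main.v *)
From HB Require Import structures.
Require Import Defs.
From mathcomp Require Import all_boot all_algebra finmap ring.
From mathcomp.classical Require Import boolp classical_sets.
From mathcomp.multinomials Require Import -(notations) monalg.
From mathcomp.multinomials Require Import mpoly.

Set Implicit Arguments.
Unset Strict Implicit.
Unset Printing Implicit Defensive.

Import GRing.Theory.
Local Open Scope classical_set_scope.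
Local Open Scope ring_scope.

(** Why the theorem holds.

A sequence u is tied to operators x_1, x_2, ... by a Newton relation when
n u_n = x_1 u_{n-1} + x_2 u_{n-2} + ... + x_n u_0 for all n.  In generating
functions this is t u'(t) = x(t) u(t); given u_0 it determines u from x in
characteristic zero ([newton_uniq]), and it determines x from u when u_0 = 1
([newton_ring_uniq]).

Differentiating phi_t = (X + tF)^* in t, composing with the inverse of phi_t
and multiplying by t gives a derivation R(t) with t phi_t' = R(t) phi_t.  Comparing
values at x_i + t f_i, one finds that the coefficients of R(t) are the right
powers of D up to sign: the operators lambda(Z_n) satisfy the Newton relation
with x_i = (-1)^(i-1) D^[i] ([newton_lambda_coef]).

The same relation, read in NSymm, defines elements R_i from the Z_n.  The
Newton relation is compatible with bilinear convolutions ([newton_conv]), and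
Delta(Z_n) is such a convolution, so the R_i are primitive
([newton_primitive]); moreover lambda(R_i) = (-1)^(i-1) D^[i]
([newton_lambda]).  Hence both images contain all D^[i].

Conversely let c be the sequence with c_0 = 1 satisfying the Newton relation
with x_i = Z_i, and let chi be the endomorphism Z_n |-> c_n of NSymm.  Then
lambda is chi followed by Z_i |-> (-1)^(i-1) D^[i] ([lambda_factor]), so that
lambda(NSymm) lies in A_D.  Further, chi carries Delta to the coproduct Delta0
for which the letters Z_i themselves are primitive ([free_lift2_Delta]).  So chi
sends Prim to primitive elements for Delta0, and by the Dynkin-Specht-Wever
formula ([dynkin_specht_wever]) these are combinations of iterated brackets
of letters.  Their images are combinations of iterated brackets of right
powers, which lie in L_D. *)

(** * Newton relations *)

Section Newton.

Definition newton (V : zmodType) (x : nat -> V -> V) (u : nat -> V) :=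
  forall n, u n *+ n = \sum_(i < n) x i.+1 (u (n - i.+1)%N).

(** Recursive definition of a sequence when each term depends on all earlier
    ones. *)
Lemma course_of_values (T : Type) (x0 : T) (step : nat -> (nat -> T) -> T) :
  (forall n f g, (forall i, (i < n)%N -> f i = g i) -> step n f = step n g) ->
  exists f, forall n, f n = step n f.
Proof.
move=> stepP; pose fix s n :=
  if n is m.+1 then rcons (s m) (step m (nth x0 (s m))) else [::].
have sz n : size (s n) = n by elim: n => //= n IHn; rewrite size_rcons IHn.
have sE m i : (i < m)%N -> nth x0 (s m) i = nth x0 (s i.+1) i.
  elim: m => // m IHm; rewrite ltnS leq_eqVlt => /predU1P[-> //|lt_im].
  by rewrite /= nth_rcons sz lt_im IHm.
exists (fun n => nth x0 (s n.+1) n) => n.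
by rewrite [LHS]/= nth_rcons sz ltnn eqxx; apply: stepP => i /sE.
Qed.

Lemma triangle_exchange (V : zmodType) n (H : nat -> nat -> V) :
  \sum_(i < n.+1) \sum_(s < n - i) H i s =
  \sum_(s < n) \sum_(i < (n - s.+1).+1) H i s.
Proof.
under eq_bigr => i _ do rewrite (big_ord_widen n (H i)) ?leq_subr //.
rewrite (exchange_big_dep predT) //=; apply: eq_bigr => s _.
rewrite (big_ord_widen n.+1 (H^~ s)) ?ltnS ?leq_subr //; apply: eq_bigl => i.
by rewrite ltnS !ltn_subRL leq_subRL // addnC.
Qed.

Definition conv (U V W : zmodType) (b : U -> V -> W)
    (u : nat -> U) (v : nat -> V) n :=
  \sum_(i < n.+1) b (u i) (v (n - i)%N).

(** In generating functions this is the product rule for t d/dt, with z(t)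
    acting on b(u(t), v(t)) through x(t) on the left and y(t) on the right.
    It serves twice: for the product of P_n, on which derivations act by
    Leibniz, and for the tensor product, on which x (x) 1 + 1 (x) y acts. *)
Lemma newton_conv (U V W : zmodType) (b : U -> V -> W) x y z u v :
  (forall q, {morph b^~ q : p p' / p + p'}) ->
  (forall p, {morph b p : q q' / q + q'}) ->
  (forall s, {morph z s : a a' / a + a'}) ->
  (forall s p q, z s (b p q) = b (x s p) q + b p (y s q)) ->
  newton x u -> newton y v -> newton z (conv b u v).
Proof.
move=> bl br za zb xu yv.
have morph0 (A B : zmodType) (f : A -> B) :
    {morph f : p p' / p + p'} -> f 0 = 0.
  by move=> fD; apply: (addIr (f 0)); rewrite -fD !add0r.
have morphMn (A B : zmodType) (f : A -> B) : {morph f : p p' / p + p'} ->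
    forall p m, f (p *+ m) = f p *+ m.
  by move=> fD p; elim=> [|m IHm]; rewrite ?mulr0n ?morph0 // !mulrS fD IHm.
move=> n; rewrite /conv -sumrMnl.
transitivity (\sum_(i < n.+1) \sum_(s < i) b (x s.+1 (u (i - s.+1)%N)) (v (n - i)%N)
  + \sum_(i < n.+1) \sum_(s < n - i) b (u i) (y s.+1 (v (n - i - s.+1)%N))).
  rewrite -big_split; apply: eq_bigr => i _.
  (* The degree n is split as i + (n - i), one summand for each factor. *)
  rewrite -[X in _ *+ X](subnKC (_ : (i <= n)%N)) -1?ltnS //.
  rewrite mulrnDr -(morphMn _ _ (b^~ _)) // -morphMn // xu yv; congr (_ + _).
    by apply: (big_morph (b^~ _)); [exact: bl | exact: (morph0 _ _ (b^~ _))].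
  by apply: (big_morph (b _)); [exact: br | exact: morph0].
transitivity (\sum_(s < n) \sum_(i < (n - s.+1).+1)
    b (x s.+1 (u i)) (v (n - s.+1 - i)%N)
  + \sum_(s < n) \sum_(i < (n - s.+1).+1)
    b (u i) (y s.+1 (v (n - s.+1 - i)%N))).
  congr (_ + _); last first.
    rewrite (triangle_exchange _ (fun i s => b (u i) (y s.+1 (v (n - i - s.+1)%N)))).
    by do 2!apply: eq_bigr => ? _; rewrite subnAC.
  rewrite (reindex_inj rev_ord_inj) /=.
  under eq_bigr => i _ do rewrite subSS subKn -1?ltnS //.
  rewrite (triangle_exchange _ (fun i s => b (x s.+1 (u (n - i - s.+1)%N)) (v i))).
  apply: eq_bigr => s _; rewrite (reindex_inj rev_ord_inj) /=; apply: eq_bigr.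
  by move=> i _; rewrite subSS subnAC subKn // -ltnS.
rewrite -big_split; apply: eq_bigr => s _.
rewrite (big_morph (z _) (za _) (morph0 _ _ _ (za _))) -big_split.
by apply: eq_bigr => i _; rewrite zb.
Qed.

Lemma eq_newton (V : zmodType) (x y : nat -> V -> V) (u v : nat -> V) :
  (forall i, x i.+1 =1 y i.+1) -> u =1 v -> newton x u -> newton y v.
Proof.
by move=> xy uv xu n; rewrite -uv xu; apply: eq_bigr => i _; rewrite xy uv.
Qed.

Lemma newton_linear (k : nzRingType) (V : lmodType k) (x : nat -> {linear V -> V}) c u v :
  newton (fun i => x i) u -> newton (fun i => x i) v ->
  newton (fun i => x i) (fun n => c *: u n + v n).
Proof.
move=> xu xv n; rewrite mulrnDl scalerMnr xu xv scaler_sumr -big_split.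
by apply: eq_bigr => i _; rewrite linearP.
Qed.

Section Char0.
Variables (k : fieldType) (k_char0 : [pchar k] =i pred0).

Lemma natr_neq0 n : n.+1%:R != 0 :> k.
Proof. by rewrite (pcharf0P k).1. Qed.

Lemma mulrSn_inj (V : lmodType k) n : injective (fun v : V => v *+ n.+1).
Proof.
move=> v w /=; rewrite -!scaler_nat => /(congr1 ( *:%R n.+1%:R^-1)).
by rewrite !scalerA mulVf ?natr_neq0 // !scale1r.
Qed.

Lemma newton_uniq (V : lmodType k) (x : nat -> V -> V) u v :
  newton x u -> newton x v -> u 0%N = v 0%N -> u =1 v.
Proof.
move=> xu xv uv0; elim/ltn_ind=> -[//|n] IHn.
apply: (@mulrSn_inj V n); rewrite /= xu xv; apply: eq_bigr => i _.
by rewrite IHn // subSS ltnS leq_subr.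
Qed.

(** The term of index n is obtained from the earlier ones by dividing by n. *)
Lemma newton_exists (V : lmodType k) (x : nat -> V -> V) v :
  exists2 u, u 0%N = v & newton x u.
Proof.
pose step n (f : nat -> V) := if n is 0 then v else
  n%:R^-1 *: \sum_(i < n) x i.+1 (f (n - i.+1)%N).
have [[//|n] f g fg|u uE] := @course_of_values V 0 step.
  congr (_ *: _); apply: eq_bigr => i _; rewrite fg // subSS ltnS leq_subr //.
exists u => [|[|n]]; rewrite uE // ?big_ord0 //= -scaler_nat scalerA mulfV ?scale1r //.
exact: natr_neq0.
Qed.

End Char0.

(** The coefficient of index n multiplies u 0 = 1 in the relation of index n,
    so it is determined by the earlier ones without any division. *)
Lemma newton_ring_uniq (A : nzRingType) (x y : nat -> A) u :
  u 0%N = 1 -> newton (fun i => *%R (x i)) u -> newton (fun i => *%R (y i)) u ->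
  forall n, x n.+1 = y n.+1.
Proof.
move=> u0 xu yu; elim/ltn_ind=> n IHn.
have := xu n.+1; rewrite yu !big_ord_recr /= subnn u0 !mulr1.
by rewrite (eq_bigr _ (fun i _ => congr1 ( *%R^~ _) (IHn _ (ltn_ord i)))) => /addrI.
Qed.

Lemma newton_ring_exists (A : nzRingType) (u : nat -> A) :
  u 0%N = 1 -> exists x, newton (fun i => *%R (x i)) u.
Proof.
move=> u0; pose step n (f : nat -> A) :=
  u n *+ n - \sum_(i < n.-1) f i.+1 * u (n - i.+1)%N.
have [n f g fg|x xE] := @course_of_values A 0 step.
  congr (_ - _); apply: eq_bigr => i _; rewrite fg //.
  by case: n i fg => [[]|n [i ltin]].
exists x => -[|n]; first by rewrite big_ord0 mulr0n.
by rewrite big_ord_recr /= subnn u0 mulr1 [x n.+1]xE /step addrC subrK.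
Qed.

End Newton.

(** * The Newton relation for the operators lambda(Z_n) *)

Section Operators.
Variables (k : fieldType) (n : nat).
Local Notation P := {mpoly k[n]}.

Lemma derivation1 (d : endo k n) : derivations d -> d 1 = 0.
Proof.
by move=> /(_ 1 1); rewrite !mulr1 mul1r => /esym/(canRL (addrK _)); rewrite subrr.
Qed.

Lemma subspace_derivations : subspace (@derivations k n).
Proof.
split=> [a b|c f g df dg a b]; first by rewrite !endo0E mul0r mulr0 addr0.
rewrite !(endoDE, endoZE) df dg scalerDr !mulrDl !mulrDr -!scalerAl -!scalerAr.
by rewrite addrACA.
Qed.

Lemma lie_derivations : lie_subalgebra (@derivations k n).
Proof.
split=> [|f g df dg a b]; first exact: subspace_derivations.
rewrite !(endoDE, endoNE, endoME) df dg !linearD /= !df !dg.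
ring.
Qed.

Variable F : n.-tuple P.

Lemma mderiv_var (i j : 'I_n) : ('X_i : P)^`M(j) = (i == j)%:R.
Proof.
rewrite mderivX mnm1E; case: eqVneq => [->|_]; last by rewrite scale0r.
rewrite scale1r (_ : (_ - _)%MM = 0%MM) ?mpolyX0 //.
by apply/mnmP => i'; rewrite mnmBE mnm0E subnn.
Qed.

Lemma field_var (a : 'I_n -> P) i : (\sum_(j < n) mulop (a j) * pder k j) 'X_i = a i.
Proof.
rewrite endo_sumE (bigD1 i) //= big1 ?addr0 => [|j /negPf ji].
  by rewrite mderiv_var eqxx mulr1.
by rewrite mderiv_var eq_sym ji mulr0.
Qed.

Lemma rpowS m : rpow (D_F F) m.+2 = lsprod (rpow (D_F F) m.+1) (D_F F).
Proof. by []. Qed.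

Lemma rpow_derivation m : derivations (rpow (D_F F) m).
Proof. by case: m => [|[|m]]; apply: derivations_sum. Qed.

(** For m > 0, the coefficient of t^(m-1) in the derivation obtained by
    composing d/dt phi_t with the inverse of phi_t, where phi_t = (X + tF)^*. *)
Definition srpow m : endo k n := (-1) ^+ m.-1 *: rpow (D_F F) m.

Lemma srpow_derivation m : derivations (srpow m).
Proof.
rewrite -[srpow m]addr0; have [d0 dl] := subspace_derivations.
by apply: dl => //; apply: rpow_derivation.
Qed.

Lemma srpow1_var i : srpow 1 'X_i = tnth F i.
Proof. by rewrite /srpow expr0 scale1r /rpow /= field_var. Qed.

(** The recursion D^[m+2](x_i) = D^[m+1](D(x_i)) = D^[m+1](f_i), with signs.
    It makes the Newton relation for lambda(Z_n)(x_i) telescope. *)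
Lemma srpowS_var m i : srpow m.+2 'X_i = - srpow m.+1 (tnth F i).
Proof.
rewrite /srpow !endoZE rpowS /lsprod field_var field_var /=.
by rewrite exprS mulN1r scaleNr.
Qed.

Lemma lambda_coef_var m i :
  lambda_coef F m 'X_i = 'X_i *+ (m == 0%N) + tnth F i *+ (m == 1%N).
Proof.
rewrite -[LHS]/((XtF F ('X_i)%:P)`_m) XtF_var coefD coefC coefXM coefC.
by case: m => [|[|m]]; rewrite /= ?mulr0n ?mulr1n.
Qed.

Lemma lambda_coefM m (a b : P) :
  lambda_coef F m (a * b) =
  conv *%R (fun i => lambda_coef F i a) (fun i => lambda_coef F i b) m.
Proof.
by rewrite -[LHS]/((XtF F (a * b)%:P)`_m) polyCM rmorphM coefM.
Qed.

Lemma lambda_coef1 m : lambda_coef F m 1 = (m == 0%N)%:R.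
Proof. by rewrite -[LHS]/((XtF F 1%:P)`_m) rmorph1 coef1. Qed.

(** The set T of the a for which the relation holds is a subspace, contains 1
    because derivations vanish there, and is stable under products because phi_t
    is multiplicative and the signed right powers are derivations.  On a
    variable only lambda(Z_0) and lambda(Z_1) are nonzero, and the relation
    reduces to the recursion for right powers. *)
Lemma newton_lambda_coef_at (a : P) :
  newton (fun i => srpow i : P -> P) (fun m => lambda_coef F m a).
Proof.
pose T a := newton (fun i => srpow i : P -> P) (fun m => lambda_coef F m a).
have TM p q : T p -> T q -> T (p * q).
  move=> Tp Tq m; under eq_bigr do rewrite lambda_coefM; rewrite lambda_coefM.
  move: m; apply: (newton_conv (z := fun i => srpow i : P -> P) _ _ _ _ Tp Tq).
  - by move=> ? ? ?; apply: mulrDl.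
  - by move=> ? ? ?; apply: mulrDr.
  - by move=> ? ? ?; apply: linearD.
  - by move=> ? ? ?; apply: srpow_derivation.
have T1 : T 1.
  move=> m; rewrite lambda_coef1 big1 => [|i _].
    by case: m => [|m]; rewrite ?mulr0n ?mul0rn.
  rewrite lambda_coef1; case: (_ == _); last exact: linear0.
  by apply/derivation1/srpow_derivation.
have TX i : T 'X_i.
  pose u m := lambda_coef F m 'X_i; have uE m : u m = _ := lambda_coef_var m i.
  rewrite -[T _]/(newton (fun j => srpow j : P -> P) u); clearbody u.
  move: (srpow) (srpow1_var i) (srpowS_var ^~ i) => r r1 rS [|[|m]].
  - by rewrite big_ord0.
  - by rewrite big_ord1 !uE subnn !mulr0n mulr1n add0r addr0 r1.
  (* Only r_{m+2}(x_i) and r_{m+1}(f_i) survive, and they cancel. *)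
  rewrite !big_ord_recr big1 /= => [|[j lt_jm] _ /=].
    by rewrite !uE subnn subSnn !mulr0n !mulr1n !add0r !addr0 mul0rn rS subrr.
  by rewrite uE !subSS subSn 1?ltnW // eqSS subn_eq0 leqNgt lt_jm addr0 linear0.
have Tlin c p q : T p -> T q -> T (c *: p + q).
  move=> Tp Tq; apply: eq_newton (newton_linear c Tp Tq) => // m.
  by rewrite linearP.
have T0 : T 0.
  by move=> m; rewrite linear0 mul0rn big1 // => i _; rewrite !linear0.
suff: T a by []; clearbody T; elim/mpolyind: a => // c m p _ _ Tp; apply: Tlin => //.
rewrite mpolyXE_id; elim/big_ind: _ => // i _.
by elim: (m i) => // l; rewrite exprS; apply: TM.
Qed.

Lemma newton_lambda_coef : newton (fun i => *%R (srpow i)) (lambda_coef F).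
Proof.
move=> m; apply: endoP => a; rewrite endo_sumE -newton_lambda_coef_at.
by elim: m {1 3}m => [|m IHm] // l; rewrite !mulrS endoDE IHm.
Qed.

Lemma lambda_coef0 : lambda_coef F 0 = 1.
Proof. by apply: endoP => a; rewrite -[LHS]/((XtF F a%:P)`_0) XtF_coef0. Qed.

End Operators.

(** * Linear maps and bases *)

Section LinearMaps.
Variable k : fieldType.

Lemma linear_id (U : lmodType k) : linear (fun p : U => p).
Proof. by []. Qed.

Lemma linear_const0 (U V : lmodType k) : linear (fun _ : U => 0 : V).
Proof. by move=> c p q; rewrite scaler0 addr0. Qed.

Lemma linear_comp (U V W : lmodType k) (f : V -> W) (g : U -> V) :
  linear f -> linear g -> linear (fun p => f (g p)).
Proof. by move=> fl gl c p q; rewrite gl fl. Qed.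

Lemma linear_add (U V : lmodType k) (f g : U -> V) :
  linear f -> linear g -> linear (fun p => f p + g p).
Proof. by move=> fl gl c p q; rewrite fl gl scalerDr addrACA. Qed.

Lemma linear_opp (U V : lmodType k) (f : U -> V) :
  linear f -> linear (fun p => - f p).
Proof. by move=> fl c p q; rewrite fl opprD scalerN. Qed.

Lemma linear_muln (U V : lmodType k) (f : U -> V) n :
  linear f -> linear (fun p => f p *+ n).
Proof. by move=> fl c p q; rewrite fl mulrnDl scalerMnr. Qed.

Lemma linear_mulr (U : lmodType k) (A : algType k) (f : U -> A) a :
  linear f -> linear (fun p => f p * a).
Proof. by move=> fl c p q; rewrite fl mulrDl scalerAl. Qed.

Lemma linear_mull (U : lmodType k) (A : algType k) (f : U -> A) a :
  linear f -> linear (fun p => a * f p).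
Proof. by move=> fl c p q; rewrite fl mulrDr scalerAr. Qed.

Lemma linear_0E (U V : lmodType k) (f : U -> V) : linear f -> f 0 = 0.
Proof.
by move=> fl; rewrite -[X in f X](addNr 0) -scaleN1r fl scaleN1r addNr.
Qed.

Lemma linear_scaleE (U V : lmodType k) (f : U -> V) c p :
  linear f -> f (c *: p) = c *: f p.
Proof. by move=> fl; rewrite -[c *: p]addr0 fl linear_0E // addr0. Qed.

Lemma linear_addE (U V : lmodType k) (f : U -> V) p q :
  linear f -> f (p + q) = f p + f q.
Proof. by move=> fl; rewrite -[p]scale1r fl !scale1r. Qed.

Lemma linear_subE (U V : lmodType k) (f : U -> V) p q :
  linear f -> f (p - q) = f p - f q.
Proof.
by move=> fl; rewrite linear_addE // -scaleN1r linear_scaleE // scaleN1r.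
Qed.

Lemma linear_bigsum (U V : lmodType k) (f : U -> V) I (r : seq I) (g : I -> U) :
  linear f -> f (\sum_(i <- r) g i) = \sum_(i <- r) f (g i).
Proof.
move=> fl; elim/big_rec2: _ => [|i p q _ <-]; first exact: linear_0E.
exact: linear_addE.
Qed.

End LinearMaps.

Section FreeModule.
Variables (k : fieldType) (K : choiceType).
Local Notation malg := (monalg.malg K k).

Definition base (u : K) : malg := monalg.mkmalgU u 1.

Lemma malg_expand (p : malg) :
  p = \sum_(u <- monalg.msupp p) monalg.mcoeff u p *: base u.
Proof.
rewrite {1}[p]monalg.monalgE; apply: eq_bigr => u _; apply/monalg.malgP => v.
by rewrite monalg.mcoeffZ !monalg.mcoeffU mulrnAr mulr1.
Qed.

Lemma linear_mcoeff u : linear (monalg.mcoeff u : malg -> k^o).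
Proof. by move=> c p q; rewrite monalg.mcoeffD monalg.mcoeffZ. Qed.

Variable V : lmodType k.

Lemma linear_ext (f g : malg -> V) : linear f -> linear g ->
  (forall u, f (base u) = g (base u)) -> f =1 g.
Proof.
move=> fl gl fg p; rewrite [p]malg_expand !linear_bigsum //.
by apply: eq_bigr => u _; rewrite !linear_scaleE // fg.
Qed.

End FreeModule.

HB.lock Definition linext (k : fieldType) (K : choiceType) (V : lmodType k)
    (h : K -> V) (p : monalg.malg K k) : V :=
  \sum_(u <- monalg.msupp p) monalg.mcoeff u p *: h u.

Section LinearExtension.
Variables (k : fieldType) (K : choiceType) (V : lmodType k) (h : K -> V).
Local Notation linext := (linext h).

Lemma linextEw (d : {fset K}) p : (monalg.msupp p `<=` d)%fset ->
  linext p = \sum_(u <- d) monalg.mcoeff u p *: h u.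
Proof.
move=> pd; rewrite linext.unlock (big_fset_incl _ pd) // => u _ up.
by rewrite monalg.mcoeff_outdom // scale0r.
Qed.

Lemma linext_linear : linear linext.
Proof.
move=> c p q; pose d := (monalg.msupp p `|` monalg.msupp q `|` monalg.msupp (c *: p + q))%fset.
have pd : (monalg.msupp p `<=` d)%fset by rewrite /d -fsetUA fsubsetUl.
have qd : (monalg.msupp q `<=` d)%fset by rewrite /d -fsetUA fsetUCA fsubsetUl.
have pqd : (monalg.msupp (c *: p + q) `<=` d)%fset by rewrite /d fsubsetUr.
rewrite (linextEw pd) (linextEw qd) (linextEw pqd).
rewrite scaler_sumr -big_split; apply: eq_bigr => u _.
by rewrite monalg.mcoeffD monalg.mcoeffZ scalerDl scalerA.
Qed.

Lemma linext_base u : linext (base k u) = h u.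
Proof.
rewrite (@linextEw [fset u]%fset) ?monalg.msuppU_le // big_seq_fset1.
by rewrite monalg.mcoeffUU scale1r.
Qed.

End LinearExtension.

(** * The free algebra and its tensor square *)

Section Tensor.
Variables (k : fieldType) (M N : monomType).
Implicit Types (c : k) (p : monalg.malg M k) (q : monalg.malg N k).

Lemma tens_linearl q : linear ((@tens k M N)^~ q).
Proof.
move=> c p p'; apply/monalg.malgP => -[u v].
rewrite monalg.mcoeffD monalg.mcoeffZ !mcoeff_tens.
by rewrite monalg.mcoeffD monalg.mcoeffZ mulrDl mulrA.
Qed.

Lemma tens_linearr p : linear (@tens k M N p).
Proof.
move=> c q q'; apply/monalg.malgP => -[u v].
rewrite monalg.mcoeffD monalg.mcoeffZ !mcoeff_tens.
by rewrite monalg.mcoeffD monalg.mcoeffZ mulrDr mulrCA.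
Qed.

Lemma tens_base (u : M) (v : N) : tens (base k u) (base k v) = base k (u, v).
Proof.
apply/monalg.malgP => -[s t]; rewrite mcoeff_tens !monalg.mcoeffU xpair_eqE.
by rewrite mulr_natl -mulrnA mulnb andbC.
Qed.

End Tensor.

(** The letter j of a word is the variable Z_{j+1}. *)
HB.lock Definition mono (k : fieldType) (w : seq nat) : nsymm k :=
  base k (monalg.FMonom w).

HB.lock Definition mono2 (k : fieldType) (u v : seq nat) : nsymm2 k :=
  base k (monalg.FMonom u, monalg.FMonom v).

Section FreeAlgebra.
Variable k : fieldType.
Local Notation mono := (mono k).
Local Notation mono2 := (mono2 k).


Lemma nsymm_ext (V : lmodType k) (f g : nsymm k -> V) : linear f -> linear g ->
  (forall w, f (mono w) = g (mono w)) -> f =1 g.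
Proof. by move=> fl gl fg; apply: linear_ext => // -[w]; have := fg w; rewrite mono.unlock. Qed.

Lemma nsymm2_ext (V : lmodType k) (f g : nsymm2 k -> V) : linear f -> linear g ->
  (forall u v, f (mono2 u v) = g (mono2 u v)) -> f =1 g.
Proof. by move=> fl gl fg; apply: linear_ext => // -[[u] [v]]; have := fg u v; rewrite mono2.unlock. Qed.

Lemma mono_nil : mono [::] = 1.
Proof. by rewrite mono.unlock -monalg.fmE. Qed.

Lemma base_mul (M : monomType) (u v : M) :
  base k u * base k v = base k (mmul u v).
Proof. by rewrite monalg.malgM_def monalg.fgmulUU mulr1. Qed.

Lemma monoM u v : mono (u ++ v) = mono u * mono v.
Proof.
rewrite mono.unlock [RHS](base_mul (monalg.FMonom u) (monalg.FMonom v)).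
by rewrite -(monalg.fmE (u ++ v)).
Qed.

Lemma mono2M u v u' v' : mono2 u v * mono2 u' v' = mono2 (u ++ u') (v ++ v').
Proof.
rewrite mono2.unlock [LHS](base_mul (monalg.FMonom u, monalg.FMonom v)
  (monalg.FMonom u', monalg.FMonom v')).
by rewrite -(monalg.fmE (u ++ u')) -(monalg.fmE (v ++ v')).
Qed.

Lemma mono1 j : mono [:: j] = Z k j.+1.
Proof. by rewrite mono.unlock -monalg.fmE. Qed.

Lemma mono_cons j w : mono (j :: w) = Z k j.+1 * mono w.
Proof. by rewrite -cat1s monoM mono1. Qed.

Lemma mono_rcons w j : mono (rcons w j) = mono w * Z k j.+1.
Proof. by rewrite -cats1 monoM mono1. Qed.

Lemma tens2_mono u v : tens2 (mono u) (mono v) = mono2 u v.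
Proof. by rewrite mono.unlock mono2.unlock; apply: tens_base. Qed.

Lemma mono2_nil : mono2 [::] [::] = 1.
Proof. by rewrite mono2.unlock -monalg.fmE. Qed.

Lemma linext_mono (V : lmodType k) (h : monalg.fmonom nat -> V) w :
  linext h (mono w) = h (monalg.FMonom w).
Proof. by rewrite mono.unlock linext_base. Qed.

Lemma linext_mono2 (V : lmodType k)
    (h : monalg.fmonom nat * monalg.fmonom nat -> V) u v :
  linext h (mono2 u v) = h (monalg.FMonom u, monalg.FMonom v).
Proof. by rewrite mono2.unlock linext_base. Qed.

Lemma nsymm_expand (p : nsymm k) :
  p = \sum_(w <- monalg.msupp p) monalg.mcoeff w p *: mono w.
Proof.
by rewrite {1}[p]malg_expand mono.unlock; apply: eq_bigr => -[w].
Qed.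

Lemma mcoeff_mono (w : seq nat) (u : monalg.fmonom nat) :
  monalg.mcoeff u (mono w) = (w == u :> seq nat)%:R.
Proof. by rewrite mono.unlock monalg.mcoeffU. Qed.

Lemma tens2_linearl (q : nsymm k) : linear ((@tens2 k)^~ q).
Proof. exact: tens_linearl. Qed.

Lemma tens2_linearr (p : nsymm k) : linear (tens2 p).
Proof. exact: tens_linearr. Qed.

Lemma tens2M (p q p' q' : nsymm k) :
  tens2 p q * tens2 p' q' = tens2 (p * p') (q * q').
Proof.
move: p; apply: nsymm_ext => [||u].
- exact/linear_mulr/tens2_linearl.
- by apply: linear_comp (@tens2_linearl _) (linear_mulr _ (@linear_id _ _)).
move: p'; apply: nsymm_ext => [||u'].
- exact/linear_mull/tens2_linearl.
- by apply: linear_comp (@tens2_linearl _) (linear_mull _ (@linear_id _ _)).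
move: q; apply: nsymm_ext => [||v].
- exact/linear_mulr/tens2_linearr.
- by apply: linear_comp (@tens2_linearr _) (linear_mulr _ (@linear_id _ _)).
move: q'; apply: nsymm_ext => [||v'].
- exact/linear_mull/tens2_linearr.
- by apply: linear_comp (@tens2_linearr _) (linear_mull _ (@linear_id _ _)).
by rewrite -!monoM !tens2_mono mono2M.
Qed.

Lemma tens2_mull (x p q : nsymm k) : tens2 x 1 * tens2 p q = tens2 (x * p) q.
Proof. by apply: etrans (tens2M _ _ _ _) _; rewrite mul1r. Qed.

Lemma tens2_mulr (y p q : nsymm k) : tens2 1 y * tens2 p q = tens2 p (y * q).
Proof. by apply: etrans (tens2M _ _ _ _) _; rewrite mul1r. Qed.

Lemma tens2_1 : tens2 1 1 = 1 :> nsymm2 k.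
Proof. by rewrite -mono_nil tens2_mono mono2_nil. Qed.

Lemma nsymm_hom_ext (A : algType k) (f g : nsymm k -> A) :
  linear f -> linear g -> f 1 = g 1 -> {morph f : p q / p * q} ->
  {morph g : p q / p * q} -> (forall i, f (Z k i.+1) = g (Z k i.+1)) -> f =1 g.
Proof.
move=> fl gl fg1 fM gM fg; apply: nsymm_ext => //.
by elim=> [|j w IHw]; rewrite ?mono_nil // mono_cons fM gM fg IHw.
Qed.

End FreeAlgebra.



(** * Coproducts and primitive elements *)

Section Maps.
Variable k : fieldType.

Section FreeLift.
Variables (A : algType k) (f : nat -> A).

Lemma free_lift_linear : linear (free_lift f : nsymm k -> A).
Proof. by move=> c p q; rewrite linearP. Qed.

Lemma free_liftM : {morph (free_lift f : nsymm k -> A) : p q / p * q}.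
Proof. exact: rmorphM. Qed.

Lemma free_lift1 : free_lift f (1 : nsymm k) = 1.
Proof. exact: rmorph1. Qed.

Lemma free_liftE i : f 0%N = 1 -> free_lift f (Z k i) = f i.
Proof. by move=> f0; case: i => [|i]; [rewrite f0; apply: free_lift1 | apply: free_liftZ]. Qed.

Lemma free_lift_mono w : free_lift f (mono k w) = free_word f (monalg.FMonom w).
Proof. by rewrite mono.unlock [free_lift _ _]monalg.mmapU /= scale1r mul1r. Qed.

Lemma newton_free_lift x u : newton (fun i => *%R (x i)) u ->
  newton (fun i => *%R (free_lift f (x i))) (fun i => free_lift f (u i)).
Proof.
move=> xu n; transitivity (free_lift f (u n *+ n)); first by rewrite raddfMn.
rewrite xu linear_bigsum; last exact: free_lift_linear.
by apply: eq_bigr => i _; rewrite free_liftM.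
Qed.

End FreeLift.

Lemma newton_tens2 x y (u v : nat -> nsymm k) :
  newton (fun i => *%R (x i)) u -> newton (fun i => *%R (y i)) v ->
  newton (fun i => *%R (tens2 (x i) 1 + tens2 1 (y i))) (conv (@tens2 k) u v).
Proof.
apply: newton_conv => [q p p'|p q q'|s a a'|s p q].
- exact: (linear_addE _ _ (@tens2_linearl k q)).
- exact: (linear_addE _ _ (@tens2_linearr k p)).
- exact: mulrDr.
- exact: (etrans (mulrDl _ _ _) (congr2 _ (tens2_mull _ _ _) (tens2_mulr _ _ _))).
Qed.

Lemma DeltaZ n : Delta (Z k n) = conv (@tens2 k) (Z k) (Z k) n.
Proof.
case: n => [|n]; last by rewrite /Delta free_liftZ.
by rewrite /Delta free_lift1 /conv big_ord1 /= tens2_1.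
Qed.

(** Both i |-> Delta (R i) and i |-> R i (x) 1 + 1 (x) R i are coefficients of
    a Newton relation for the sequence Delta (Z n): the former because Delta is
    multiplicative, the latter because that sequence is the convolution of
    Z (x) 1 and 1 (x) Z. *)
Lemma newton_primitive R : newton (fun i => *%R (R i)) (Z k) ->
  forall i, Prim (R i.+1).
Proof.
move=> RZ; apply: (@newton_ring_uniq _ (fun i => Delta (R i))
  (fun i => tens2 (R i) 1 + tens2 1 (R i)) (fun i => Delta (Z k i))).
- by rewrite /Delta free_lift1.
- exact: newton_free_lift.
- by apply: eq_newton (newton_tens2 RZ RZ) => // n; exact/esym/DeltaZ.
Qed.

(** The coproduct of the free algebra with primitive letters. *)
Definition Delta0 : nsymm k -> nsymm2 k :=
  free_lift (fun i => tens2 (Z k i) 1 + tens2 1 (Z k i)).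

Section TensorSquare.
Variable c : nat -> nsymm k.

(** The tensor square of the algebra morphism Z_i |-> c_i. *)
Definition free_lift2 : nsymm2 k -> nsymm2 k :=
  linext (fun uv => tens2 (free_word c uv.1) (free_word c uv.2)).

Lemma free_lift2_linear : linear free_lift2.
Proof. exact: linext_linear. Qed.

Lemma free_lift2_tens2 p q : free_lift2 (tens2 p q) = tens2 (free_lift c p) (free_lift c q).
Proof.
move: p; apply: nsymm_ext => [||u].
- exact: linear_comp free_lift2_linear (@tens2_linearl _ _).
- exact: linear_comp (@tens2_linearl _ _) (@free_lift_linear _ _).
move: q; apply: nsymm_ext => [||v].
- exact: linear_comp free_lift2_linear (@tens2_linearr _ _).
- exact: linear_comp (@tens2_linearr _ _) (@free_lift_linear _ _).
by rewrite !free_lift_mono tens2_mono /free_lift2 linext_mono2.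
Qed.

Lemma free_lift2M : {morph free_lift2 : p q / p * q}.
Proof.
move=> p q; move: p; apply: nsymm2_ext => [||u v].
- exact: linear_comp free_lift2_linear (linear_mulr _ (@linear_id _ _)).
- exact: linear_mulr free_lift2_linear.
move: q; apply: nsymm2_ext => [||u' v'].
- exact: linear_comp free_lift2_linear (linear_mull _ (@linear_id _ _)).
- exact: linear_mull free_lift2_linear.
have lE r s : free_lift2 (mono2 k r s) =
    tens2 (free_lift c (mono k r)) (free_lift c (mono k s)).
  by rewrite -tens2_mono; apply: free_lift2_tens2.
apply: etrans (congr1 free_lift2 (mono2M _ _ _ _ _)) _.
apply: etrans (lE _ _) _.
apply: etrans (esym (congr2 _ (lE _ _) (lE _ _))).
apply: etrans (esym (tens2M _ _ _ _)).
by apply: congr2; apply: etrans (congr1 _ (monoM _ _ _)) (free_liftM _ _ _).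
Qed.

Hypothesis k_char0 : [pchar k] =i pred0.
Hypothesis c0 : c 0%N = 1.
Hypothesis c_newton : newton (fun i => *%R (Z k i)) c.

(** Both sides are algebra morphisms.  On Z_n the left one is the convolution
    of c with itself and the right one is Delta0 (c n); both satisfy the Newton
    relation with coefficients Z_i (x) 1 + 1 (x) Z_i. *)
Lemma free_lift2_Delta p : free_lift2 (Delta p) = Delta0 (free_lift c p).
Proof.
move: p; apply: nsymm_hom_ext => [||||p q|i].
- exact: linear_comp free_lift2_linear (@free_lift_linear _ _).
- exact: linear_comp (@free_lift_linear _ _) (@free_lift_linear _ _).
- by rewrite /Delta /Delta0 !free_lift1 -tens2_1 free_lift2_tens2 !free_lift1.
- by move=> p q; rewrite /Delta free_liftM free_lift2M.
- by rewrite /Delta0 !free_liftM.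
rewrite DeltaZ /conv linear_bigsum; last exact: free_lift2_linear.
under eq_bigr do rewrite free_lift2_tens2 !free_liftE //.
rewrite free_liftE // -/(conv (@tens2 k) c c i.+1); move: i.+1.
apply: (newton_uniq k_char0 (newton_tens2 c_newton c_newton)).
  have := newton_free_lift (fun i => tens2 (Z k i) 1 + tens2 1 (Z k i)) c_newton.
  apply: eq_newton => [s a|s]; last exact: erefl.
  by congr (_ * _); apply: free_liftZ.
by rewrite /conv big_ord1 /= c0 tens2_1 /Delta0 free_lift1.
Qed.

End TensorSquare.
End Maps.

(** * The Dynkin-Specht-Wever formula *)

Section Nested.

(** The right-normed bracket [f_1, [f_2, ... [f_{m-1}, f_m]]] of a word.  For a
    one-letter word the bracket term vanishes and the first summand supplies
    the letter. *)
Fixpoint nested_bracket (A : nzRingType) (f : nat -> A) (w : seq nat) : A :=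
  if w is j :: w' then
    f j.+1 *+ nilp w' + (f j.+1 * nested_bracket f w' - nested_bracket f w' * f j.+1)
  else 0.

Lemma nested_bracket_morph (k : fieldType) (A B : algType k) (phi : A -> B) f g w :
  linear phi -> {morph phi : x y / x * y} ->
  (forall j, phi (f j.+1) = g j.+1) -> phi (nested_bracket f w) = nested_bracket g w.
Proof.
move=> phiL phiM fg; elim: w => [|j w IHw] /=; first exact: linear_0E.
rewrite linear_addE // linear_subE // !phiM fg IHw; congr (_ + _).
by rewrite -!scaler_nat linear_scaleE // fg.
Qed.

(** With d the degree derivation this is the homogeneity of brackets. *)
Lemma derivation_nested_bracket (A : nzRingType) (f : nat -> A) (d : {additive A -> A}) w :
  (forall x y, d (x * y) = d x * y + x * d y) -> (forall j, d (f j.+1) = f j.+1) ->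
  d (nested_bracket f w) = nested_bracket f w *+ size w.
Proof.
move=> dM df; elim: w => [|j w IHw] /=; first exact: raddf0.
rewrite raddfD raddfMn raddfB /= !dM df IHw mulrnDl mulrnBl mulrnAl mulrnAr.
rewrite -mulrS -mulrSr; congr (_ + _).
by case: w {IHw} => [|i w]; rewrite /= ?mulr1n ?mulr0n ?mul0rn.
Qed.

Lemma nested_bracket_closed (k : nzRingType) (A : lalgType k) (S : set A) (f : nat -> A) w :
  S 0 -> (forall (c : k) x y, S x -> S y -> S (c *: x + y)) ->
  (forall x y, S x -> S y -> S (x * y - y * x)) ->
  (forall j, S (f j.+1)) -> S (nested_bracket f w).
Proof.
move=> S0 Sl SB Sf; elim: w => //= j w IHw; rewrite -scaler_nat.
by apply: Sl => //; apply: SB.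
Qed.

End Nested.

Section Dynkin.
Variable k : fieldType.

(** The antipode belonging to Delta0, on words. *)
Definition anti (v : seq nat) : nsymm k := (-1) ^+ size v *: mono k (rev v).

Lemma anti_nil : anti [::] = 1.
Proof. by rewrite /anti scale1r mono_nil. Qed.

Lemma anti_cons j v : anti (j :: v) = - (anti v * Z k j.+1).
Proof. by rewrite /anti rev_cons mono_rcons exprS mulN1r scaleNr -scalerAl. Qed.

(** The linear map u (x) v |-> c(|u|) u S(v), with S the antipode.  For c = 1 it
    is the map behind the antipode axiom, for c = id it computes the
    convolution of the degree derivation with the antipode. *)
Definition contract (c : nat -> nat) : nsymm2 k -> nsymm k :=
  linext (fun uv : monalg.fmonom nat * monalg.fmonom nat =>
    (mono k uv.1 *+ c (size uv.1)) * anti uv.2).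

Lemma contract_linear c : linear (contract c).
Proof. exact: linext_linear. Qed.

Lemma contract_mono2 c u v :
  contract c (mono2 k u v) = (mono k u *+ c (size u)) * anti v.
Proof. exact: linext_mono2. Qed.

Lemma mono2_consl j u v : tens2 (Z k j.+1) 1 * mono2 k u v = mono2 k (j :: u) v.
Proof. by rewrite -!tens2_mono mono_cons; apply: tens2_mull. Qed.

Lemma mono2_consr j u v : tens2 1 (Z k j.+1) * mono2 k u v = mono2 k u (j :: v).
Proof. by rewrite -!tens2_mono mono_cons; apply: tens2_mulr. Qed.

Lemma contractl c j X :
  contract c (tens2 (Z k j.+1) 1 * X) = Z k j.+1 * contract (c \o S) X.
Proof.
move: X; apply: nsymm2_ext => [||u v].
- exact: linear_comp (@contract_linear _) (linear_mull _ (@linear_id _ _)).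
- exact: linear_mull (@contract_linear _).
by rewrite mono2_consl !contract_mono2 mono_cons -mulrnAr mulrA.
Qed.

Lemma contractr c j X :
  contract c (tens2 1 (Z k j.+1) * X) = - (contract c X * Z k j.+1).
Proof.
move: X; apply: nsymm2_ext => [||u v].
- exact: linear_comp (@contract_linear _) (linear_mull _ (@linear_id _ _)).
- exact: linear_opp (linear_mulr _ (@contract_linear _)).
by rewrite mono2_consr !contract_mono2 anti_cons mulrN mulrA.
Qed.

Lemma Delta0_mono j w : Delta0 (mono k (j :: w)) =
  tens2 (Z k j.+1) 1 * Delta0 (mono k w) + tens2 1 (Z k j.+1) * Delta0 (mono k w).
Proof. by rewrite mono_cons /Delta0 free_liftM free_liftZ // mulrDl. Qed.

Lemma Delta0_nil : Delta0 (mono k [::]) = mono2 k [::] [::].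
Proof. by rewrite mono_nil mono2_nil /Delta0 free_lift1. Qed.

Lemma contract_Delta0_cons c j w : contract c (Delta0 (mono k (j :: w))) =
  Z k j.+1 * contract (c \o S) (Delta0 (mono k w))
    - contract c (Delta0 (mono k w)) * Z k j.+1.
Proof.
rewrite Delta0_mono (linear_addE _ _ (@contract_linear _)).
exact: (congr2 _ (contractl _ _ _) (contractr _ _ _)).
Qed.

(** The antipode axiom: the convolution of the identity and the antipode is
    the counit. *)
Lemma contract1_Delta0 w :
  contract (fun=> 1%N) (Delta0 (mono k w)) = (nilp w)%:R.
Proof.
elim: w => [|j w IHw].
  by rewrite Delta0_nil contract_mono2 anti_nil mono_nil mulr1.
rewrite contract_Delta0_cons /comp IHw.
by case: (nilp w); rewrite ?mulr1 ?mul1r ?mulr0 ?mul0r subrr.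
Qed.

Lemma contractS X : contract S X = contract (fun=> 1%N) X + contract id X.
Proof.
move: X; apply: nsymm2_ext => [||u v]; first exact: contract_linear.
  exact: linear_add (@contract_linear _) (@contract_linear _).
by rewrite !contract_mono2 -mulrDl mulrS.
Qed.

(** The convolution of the degree derivation with the antipode is Dynkin's
    operator: multiplying a word by a letter z on the left turns the value b
    into z b - b z, up to a counit term that only one-letter words feel. *)
Lemma contract_id_Delta0 w : contract id (Delta0 (mono k w)) = nested_bracket (Z k) w.
Proof.
elim: w => [|j w IHw]; first by rewrite Delta0_nil contract_mono2 mulr0n mul0r.
rewrite contract_Delta0_cons contractS contract1_Delta0 IHw.
by rewrite mulrDr -addrA mulr_natr.
Qed.

Definition deg : nsymm k -> nsymm k :=
  linext (fun u : monalg.fmonom nat => mono k u *+ size u).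

Lemma deg_linear : linear deg.
Proof. exact: linext_linear. Qed.

Lemma deg_mono w : deg (mono k w) = mono k w *+ size w.
Proof. exact: linext_mono. Qed.

Lemma degM p q : deg (p * q) = deg p * q + p * deg q.
Proof.
move: p; apply: nsymm_ext => [||u].
- exact: linear_comp deg_linear (linear_mulr _ (@linear_id _ _)).
- exact: linear_add (linear_mulr _ deg_linear) (linear_mulr _ (@linear_id _ _)).
move: q; apply: nsymm_ext => [||v].
- exact: linear_comp deg_linear (linear_mull _ (@linear_id _ _)).
- exact: linear_add (linear_mull _ (@linear_id _ _)) (linear_mull _ deg_linear).
by rewrite -monoM !deg_mono mulrnAl mulrnAr -monoM size_cat mulrnDr.
Qed.

HB.instance Definition _ := GRing.isLinear.Build k (nsymm k) (nsymm k) *:%R deg deg_linear.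

Lemma deg_nested_bracket w : deg (nested_bracket (Z k) w) = nested_bracket (Z k) w *+ size w.
Proof.
apply: derivation_nested_bracket => [|j]; first exact: degM.
by rewrite -mono1; apply: deg_mono.
Qed.

Definition coord (u : seq nat) : nsymm k -> k^o := monalg.mcoeff (monalg.FMonom u).

Lemma coord_linear u : linear (coord u).
Proof. exact: linear_mcoeff. Qed.

Lemma coord_mono u w : coord u (mono k w) = (w == u)%:R.
Proof. by rewrite /coord mcoeff_mono. Qed.

Lemma coord_deg u p : coord u (deg p) = coord u p *+ size u.
Proof.
move: p; apply: nsymm_ext => [||w].
- exact: linear_comp (@coord_linear _) deg_linear.
- exact: linear_muln (@coord_linear _).
rewrite deg_mono -scaler_nat (linear_scaleE _ _ (@coord_linear _)) coord_mono.
by rewrite scaler_nat; case: eqP => [->|_] //; rewrite !mul0rn.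
Qed.

Hypothesis k_char0 : [pchar k] =i pred0.

Lemma contract_tens2_1 c w : contract c (tens2 (mono k w) 1) = mono k w *+ c (size w).
Proof. by rewrite -mono_nil tens2_mono contract_mono2 anti_nil mulr1. Qed.

Lemma contract_1_tens2 c w : contract c (tens2 1 (mono k w)) = anti w *+ c 0%N.
Proof. by rewrite -mono_nil tens2_mono contract_mono2 mono_nil mulrnAl mul1r. Qed.

Lemma Delta0_linear : linear (@Delta0 k : nsymm k -> nsymm2 k).
Proof. exact: free_lift_linear. Qed.

Lemma contract_Delta0_linear c : linear (fun p => contract c (Delta0 p)).
Proof. exact: linear_comp (@contract_linear _) Delta0_linear. Qed.

(** On 1 (x) q the degree factor vanishes, and on q (x) 1 the antipode is
    trivial. *)
Lemma primitive_deg q : Delta0 q = tens2 q 1 + tens2 1 q ->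
  contract id (Delta0 q) = deg q.
Proof.
move=> ->; rewrite (linear_addE _ _ (@contract_linear _)).
rewrite -[RHS]addr0; congr (_ + _); move: q.
  apply: nsymm_ext => [||w]; last by rewrite contract_tens2_1 deg_mono.
    exact: linear_comp (@contract_linear _) (@tens2_linearl _ _).
  exact: deg_linear.
apply: nsymm_ext => [||w]; last by rewrite contract_1_tens2.
  exact: linear_comp (@contract_linear _) (@tens2_linearr _ _).
exact: linear_const0.
Qed.

(** Contracting with c = 1 turns the equation for q into q + S(q) = counit of
    q, whose constant coefficient reads 2 q_1 = q_1. *)
Lemma primitive_constant q : Delta0 q = tens2 q 1 + tens2 1 q ->
  coord [::] q = 0.
Proof.
move=> qprim; set e := coord [::]; have el : linear e := @coord_linear [::].
have e_mono w : e (mono k w) = (nilp w)%:R by rewrite /e coord_mono; case: w.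
have contrl := @contract_linear (fun=> 1%N).
have e1 p : e (contract (fun=> 1%N) (tens2 p 1)) = e p.
  move: p; apply: nsymm_ext => [||w] //.
    exact: linear_comp el (linear_comp contrl (@tens2_linearl _ _)).
  by rewrite contract_tens2_1 mulr1n.
have e2 p : e (contract (fun=> 1%N) (tens2 1 p)) = e p.
  move: p; apply: nsymm_ext => [||w] //.
    exact: linear_comp el (linear_comp contrl (@tens2_linearr _ _)).
  rewrite contract_1_tens2 mulr1n /anti (linear_scaleE _ _ el) !e_mono.
  by case: w => [|j w]; rewrite ?expr0 ?scale1r // /nilp size_rev scaler0.
have e3 p : e (contract (fun=> 1%N) (Delta0 p)) = e p.
  move: p; apply: nsymm_ext => [||w] //.
    exact: linear_comp el (contract_Delta0_linear _).
  rewrite contract1_Delta0 e_mono; case: w => [|j w].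
    by rewrite -mono_nil e_mono.
  by rewrite (linear_0E el).
apply: (addrI (e q)); rewrite addr0; apply: etrans (e3 q).
rewrite qprim (linear_addE _ _ contrl) (linear_addE _ _ el).
exact: (congr2 _ (esym (e1 q)) (esym (e2 q))).
Qed.

(** Dynkin's operator sends q to deg q by [primitive_deg], and to a combination
    of nested brackets by [contract_id_Delta0].  Brackets being homogeneous, the
    division by degrees can be carried out bracket by bracket; the two sides
    then have the same image under deg, hence differ by a constant, and neither
    has a constant term. *)
Lemma dynkin_specht_wever (q : nsymm k) : Delta0 q = tens2 q 1 + tens2 1 q ->
  q = \sum_(u <- monalg.msupp q)
    (monalg.mcoeff u q / (size u)%:R) *: nested_bracket (Z k) u.
Proof.
move=> qprim; set s := RHS.
have sdeg : deg s = deg q.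
  rewrite -(primitive_deg qprim) [in RHS](nsymm_expand q).
  rewrite (linear_bigsum _ _ (contract_Delta0_linear _)) (linear_bigsum _ _ deg_linear).
  apply: eq_bigr => -[w] _.
  rewrite (linear_scaleE _ _ (contract_Delta0_linear _)) (linear_scaleE _ _ deg_linear).
  rewrite deg_nested_bracket contract_id_Delta0 -scaler_nat scalerA.
  case: w => [|j w]; first by rewrite !scaler0.
  by rewrite divfK // natr_neq0.
apply/monalg.malgP => -[w]; rewrite -![monalg.mcoeff _ _]/(coord w _).
have nested0 u : coord [::] (nested_bracket (Z k) u) = 0.
  case: u => [|j u]; first exact: linear_0E (@coord_linear _).
  apply: (@mulrSn_inj k k_char0 k^o (size u)); rewrite mul0rn -scaler_nat.
  rewrite -(linear_scaleE _ _ (@coord_linear _)) scaler_nat -[_ *+ _]deg_nested_bracket.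
  exact: coord_deg.
case: w => [|j w].
  rewrite primitive_constant // /s (linear_bigsum _ _ (@coord_linear _)) big1 // => u _.
  by rewrite (linear_scaleE _ _ (@coord_linear _)) nested0 scaler0.
apply: (@mulrSn_inj k k_char0 k^o (size w)).
exact: (etrans (esym (coord_deg (j :: w) _)) (etrans (congr1 _ (esym sdeg))
  (coord_deg (j :: w) _))).
Qed.

End Dynkin.

(** * The images under lambda *)

Lemma addrACAC (V : zmodType) (a b c d : V) : (a + b) + (c + d) = (a + d) + (b + c).
Proof. by rewrite [c + d]addrC addrACA. Qed.

Lemma commutator_cancel (A : nzRingType) (x y u v w : A) :
  x * y = u + w -> y * x = v + w -> x * y - y * x = u - v.
Proof. by move=> -> ->; rewrite opprD addrACA subrr addr0. Qed.

Section PrimLie.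
Variable k : fieldType.

Definition prim_tens (p : nsymm k) : nsymm2 k := tens2 p 1 + tens2 1 p.

Lemma prim_tens_linear : linear prim_tens.
Proof. exact: linear_add (@tens2_linearl _ _) (@tens2_linearr _ _). Qed.

(** The mixed terms are symmetric in p and q, so they cancel in the
    commutator. *)
Lemma prim_tensM p q :
  prim_tens p * prim_tens q = prim_tens (p * q) + (tens2 p q + tens2 q p).
Proof.
have pq : tens2 p 1 * tens2 1 q = tens2 p q.
  exact: etrans (tens2_mull _ _ _) (congr1 ((@tens2 k)^~ q) (mulr1 p)).
have qp : tens2 1 p * tens2 q 1 = tens2 q p.
  exact: etrans (tens2_mulr _ _ _) (congr1 (tens2 q) (mulr1 p)).
apply: etrans (mulrDl _ _ _) _; apply: etrans (congr2 _ (mulrDr _ _ _) (mulrDr _ _ _)) _.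
apply: etrans (congr2 _ (congr2 _ (tens2_mull _ _ _) pq)
  (congr2 _ qp (tens2_mulr _ _ _))) _.
exact: addrACAC.
Qed.

Lemma Prim_linear : Prim (0 : nsymm k) /\
  (forall (c : k) p q, Prim p -> Prim q -> Prim (c *: p + q)).
Proof.
have dL := @free_lift_linear k _ (fun i => \sum_(j < i.+1) tens2 (Z k j) (Z k (i - j))).
split=> [|c p q pP qP].
  exact: etrans (linear_0E dL) (esym (linear_0E prim_tens_linear)).
apply: etrans (dL c p q) _.
apply: etrans (congr2 (fun x y => c *: x + y) pP qP) _.
exact: esym (prim_tens_linear c p q).
Qed.

Lemma Prim_bracket (p q : nsymm k) : Prim p -> Prim q -> Prim (p * q - q * p).
Proof.
have dL := @free_lift_linear k _ (fun i => \sum_(j < i.+1) tens2 (Z k j) (Z k (i - j))).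
have dM := @free_liftM k _ (fun i => \sum_(j < i.+1) tens2 (Z k j) (Z k (i - j))).
move=> pP qP; apply: etrans (linear_subE (p * q) (q * p) dL) _.
apply: etrans (congr2 (fun f g => f - g) (dM _ _) (dM _ _)) _.
apply: etrans (congr2 (fun x y => x * y - y * x) pP qP) _.
apply: etrans (commutator_cancel (prim_tensM p q)
  (etrans (prim_tensM q p) (congr1 _ (addrC _ _)))) _.
exact: esym (linear_subE (p * q) (q * p) prim_tens_linear).
Qed.

End PrimLie.

Section Image.
Variables (k : fieldType) (n : nat) (F : n.-tuple {mpoly k[n]}).
Hypothesis k_char0 : [pchar k] =i pred0.
Local Notation srpow := (srpow F).

Lemma lambda_Z i : lambda F (Z k i) = lambda_coef F i.
Proof. exact/free_liftE/lambda_coef0. Qed.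

(** Applying lambda to the relation that defines R gives a Newton relation for
    the sequence lambda(Z_n), whose coefficients are unique. *)
Lemma newton_lambda R : newton (fun i => *%R (R i)) (Z k) ->
  forall i, lambda F (R i.+1) = srpow i.+1.
Proof.
move=> RZ; apply: (@newton_ring_uniq (endo k n) (fun i => lambda F (R i)) srpow
  (lambda_coef F)); first exact: lambda_coef0.
  by apply: eq_newton (newton_free_lift (lambda_coef F) RZ) => // i; apply: lambda_Z.
exact: newton_lambda_coef.
Qed.

(** The images of the c_n under Z_i |-> srpow i satisfy the Newton relation that
    characterizes lambda(Z_n). *)
Lemma lambda_factor c : c 0%N = 1 -> newton (fun i => *%R (Z k i)) c ->
  forall p, lambda F p = free_lift srpow (free_lift c p).
Proof.
move=> c0 cZ; apply: nsymm_hom_ext => [||||p q|i].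
- exact: free_lift_linear.
- exact: linear_comp (@free_lift_linear _ _ _) (@free_lift_linear _ _ _).
- by rewrite !free_lift1 [LHS]free_lift1.
- exact: free_liftM.
- by rewrite !free_liftM.
rewrite lambda_Z free_liftE //; move: i.+1.
apply: (newton_uniq k_char0 (newton_lambda_coef F)); last first.
  by rewrite c0 free_lift1 lambda_coef0.
apply: eq_newton (newton_free_lift srpow cZ) => // s f.
by congr (_ * _); apply: free_liftZ.
Qed.

(** The morphism chi with chi(Z_n) = c_n turns p into an element that is
    primitive for Delta0, to which the Dynkin-Specht-Wever formula applies. *)
Lemma lambda_Prim p : Prim p -> exists r : seq (k * seq nat),
  lambda F p = \sum_(x <- r) x.1 *: nested_bracket srpow x.2.
Proof.
have [c c0 cZ] := newton_exists k_char0 (fun i => *%R (Z k i)) (1 : nsymm k).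
move=> pP; rewrite (lambda_factor c0 cZ); set q := free_lift c p.
have qP : Delta0 q = tens2 q 1 + tens2 1 q.
  rewrite -(free_lift2_Delta k_char0 c0 cZ) pP (linear_addE _ _ (free_lift2_linear c)).
  apply: etrans (congr2 _ (free_lift2_tens2 _ _ _) (free_lift2_tens2 _ _ _)) _.
  exact: (congr2 (fun x y => tens2 q x + tens2 y q) (free_lift1 c) (free_lift1 c)).
rewrite (dynkin_specht_wever k_char0 qP).
rewrite (linear_bigsum _ _ (@free_lift_linear _ _ srpow)).
exists [seq (monalg.mcoeff u q / (size u)%:R, u : seq nat) | u <- monalg.msupp q].
rewrite big_map; apply: eq_bigr => u _ /=.
rewrite (linear_scaleE _ _ (@free_lift_linear _ _ srpow)); congr (_ *: _).
apply: nested_bracket_morph => [||j]; [exact: free_lift_linear | exact: free_liftM |].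
exact: free_liftZ.
Qed.

Lemma subspace_sum (S : set (endo k n)) I (r : seq I) (g : I -> endo k n) :
  subspace S -> (forall i, S (g i)) -> S (\sum_(i <- r) g i).
Proof.
move=> [S0 Sl] Sg; elim/big_ind: _ => // f h Sf Sh.
by rewrite -[f]scale1r; apply: Sl.
Qed.

Lemma subspace_scale (S : set (endo k n)) c f : subspace S -> S f -> S (c *: f).
Proof. by move=> [S0 Sl] Sf; rewrite -[_ *: _]addr0; apply: Sl. Qed.

Lemma rpows_srpow (S : set (endo k n)) : subspace S ->
  rpows (D_F F) `<=` S <-> forall i, S (srpow i.+1).
Proof.
move=> Ss; split=> [rS i|Sr _ [[|m] // _ <-]].
  by apply: subspace_scale => //; apply: rS; exists i.+1.
rewrite -[rpow _ _](signrZK m); apply: subspace_scale => //; exact: Sr.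
Qed.

Lemma lambda_Prim_sub (S : set (endo k n)) : lie_subalgebra S ->
  rpows (D_F F) `<=` S -> lambda F @` @Prim k `<=` S.
Proof.
move=> [Ss SB] /(rpows_srpow Ss) Sr _ [p /lambda_Prim[r ->] <-].
apply: subspace_sum => // x; apply: subspace_scale => //.
by have [S0 Sl] := Ss; apply: nested_bracket_closed.
Qed.

Lemma free_lift_sub (S : set (endo k n)) f : unital_subalgebra S ->
  (forall i, S (f i.+1)) -> forall p, S (free_lift f p).
Proof.
move=> [Ss S1 SM] Sf p; rewrite [p]nsymm_expand.
rewrite (linear_bigsum _ _ (@free_lift_linear _ _ f)); apply: subspace_sum => // u.
rewrite (linear_scaleE _ _ (@free_lift_linear _ _ f)); apply: subspace_scale => //.
elim: (u : seq nat) => [|j w IHw]; first by rewrite mono_nil free_lift1.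
by rewrite mono_cons free_liftM free_liftZ //; apply: SM.
Qed.

Lemma range_lambda_sub (S : set (endo k n)) : unital_subalgebra S ->
  rpows (D_F F) `<=` S -> range (lambda F) `<=` S.
Proof.
move=> SA; have [Ss _ _] := SA; move=> /(rpows_srpow Ss) Sr _ [p _ <-].
have [c c0 cZ] := newton_exists k_char0 (fun i => *%R (Z k i)) (1 : nsymm k).
by rewrite (lambda_factor c0 cZ); apply: free_lift_sub.
Qed.

Lemma lie_lambda_Prim : lie_subalgebra (lambda F @` @Prim k).
Proof.
have lamL := @free_lift_linear _ _ (lambda_coef F).
have lamM := @free_liftM _ _ (lambda_coef F).
split=> [|_ _ [p pP <-] [q qP <-]]; first split.
- by exists 0; [exact: (Prim_linear k).1 | apply: linear_0E lamL].
- move=> c _ _ [p pP <-] [q qP <-]; exists (c *: p + q); last exact: lamL.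
  exact: (Prim_linear k).2.
exists (p * q - q * p); first exact: Prim_bracket.
apply: etrans (linear_subE (p * q) (q * p) lamL) _.
exact: (congr2 (fun f g => f - g) (lamM _ _) (lamM _ _)).
Qed.

Lemma unital_range_lambda : unital_subalgebra (range (lambda F)).
Proof.
have lamL := @free_lift_linear _ _ (lambda_coef F).
split.
- split; first by exists 0 => //; apply: linear_0E lamL.
  by move=> c _ _ [p _ <-] [q _ <-]; exists (c *: p + q) => //; apply: lamL.
- by exists 1 => //; apply: free_lift1.
- by move=> _ _ [p _ <-] [q _ <-]; exists (p * q) => //; apply: free_liftM.
Qed.

Lemma unital_weyl : unital_subalgebra (@weyl k n).
Proof.
split=> [||f g fW gW S CS].
- split=> [S [[[S0 _] _ _] _] //|c f g fW gW S CS].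
  by have [[[_ Sl] _ _] _] := CS; apply: Sl; [exact: fW | exact: gW].
- by move=> S [[]].
by have [[_ _ SM] _] := CS; apply: SM; [exact: fW | exact: gW].
Qed.

(** Multiplication operators form a subalgebra, generated by those of the
    variables. *)
Lemma mulop_weyl (a : {mpoly k[n]}) : @weyl k n (mulop a).
Proof.
have [Ws W1 WM] := unital_weyl.
have mulopL : linear (@mulop k n).
  by move=> c p q; apply: endoP => b; rewrite !(endoDE, endoZE, mulopE) mulrDl scalerAl.
rewrite [a]mpolyE (linear_bigsum _ _ mulopL); apply: (subspace_sum _ Ws) => m.
rewrite (linear_scaleE _ _ mulopL); apply: (subspace_scale _ Ws); rewrite mpolyXE_id.
have mul1 : mulop (1 : {mpoly k[n]}) = 1 by apply: endoP => b; apply: mul1r.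
have mulM (p q : {mpoly k[n]}) : mulop (p * q) = mulop p * mulop q.
  by apply: endoP => b; rewrite endoME !mulopE mulrA.
elim/big_ind: _ => [|p q pW qW|i _]; rewrite ?mul1 // ?mulM; first exact: WM.
elim: (m i) => [|l IHl]; first by rewrite expr0 mul1.
rewrite exprS mulM; apply: WM => //; apply: sub_gen_smallest.
by left; exists i.
Qed.

Lemma rpow_weyl : rpows (D_F F) `<=` @weyl k n.
Proof.
have [Ws W1 WM] := unital_weyl.
have field_weyl (a : 'I_n -> {mpoly k[n]}) :
    @weyl k n (\sum_(j < n) mulop (a j) * pder k j).
  apply: (subspace_sum _ Ws) => j; apply: WM; first exact: mulop_weyl.
  by apply: sub_gen_smallest; right; exists j.
by move=> _ [[|[|m]] // _ <-]; apply: field_weyl.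
Qed.

End Image.

Theorem corollary4 (k : fieldType) (n : nat) (F : n.-tuple {mpoly k[n]})
    (k_char0 : [pchar k] =i pred0) :
  lambda F @` @Prim k = lie_gen (D_F F) /\
  range (lambda F) = alg_gen (D_F F).
Proof.
have [R RZ] := newton_ring_exists (erefl : Z k 0 = 1).
have lamR := newton_lambda F RZ.
have [lieP uniR] := (lie_lambda_Prim F, unital_range_lambda F).
split; apply/seteqP; split.
- by move=> f pf S [[SL _] rS]; apply: (lambda_Prim_sub k_char0 SL rS).
- apply: smallest_sub; last first.
    apply/(rpows_srpow F lieP.1) => i; exists (R i.+1); last exact: lamR.
    exact: newton_primitive.
  split=> //; apply: (lambda_Prim_sub k_char0 (@lie_derivations k n)).
  by move=> _ [m _ <-]; apply: rpow_derivation.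
- by move=> f pf S [[SA _] rS]; apply: (range_lambda_sub k_char0 SA rS).
- apply: smallest_sub; last first.
    have [Ss _ _] := uniR; apply/(rpows_srpow F Ss) => i.
    by exists (R i.+1); last exact: lamR.
  split=> //; apply: (range_lambda_sub k_char0 (unital_weyl k n)).
  exact: rpow_weyl.
Qed.
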